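(* Let $P$ be a finite poset of length $1$ with $|P|\ge2$ and connected Hasse diagram. Then $U_P$ is Gorenstein if and only if $U_P$ is $\mathbb{Q}$-Gorenstein.
   Context: Length $1$ means every element is minimal or maximal. Identify $P$ with $[n]$; $N=\mathbb{Z}^n/\mathbb{Z}(1,\dots,1)$, $N_{\mathbb{R}}=N\otimes\mathbb{R}$, $M$ the dual lattice. The braid cone is $\sigma_P=\{x\in N_{\mathbb{R}}: x_i\le x_j\text{ whenever } i<_P j\}$ and $U_P$ its affine toric variety. $U_P$ is $\mathbb{Q}$-Gorenstein if there exist $u\in M$ and a positive integer $r$ with $\langle u,v\rangle=r$ for every ray generator $v$ of $\sigma_P$, and Gorenstein if this holds with $r=1$. *)

(* Defs.v *)
From HB Require Import structures.
From mathcomp Require Import all_boot all_order all_algebra.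
From mathcomp Require Import ring_quotient classical_sets reals.

Set Implicit Arguments.
Unset Strict Implicit.
Unset Printing Implicit Defensive.

Import Order.TTheory GRing.Theory Num.Theory.

Local Open Scope ring_scope.
Local Open Scope quotient_scope.

Section Poset.
Variables (d : Order.disp_t) (P : finPOrderType d).
Local Open Scope order_scope.

Definition minimal_elt (x : P) : Prop := forall y : P, y <= x -> y = x.
Definition maximal_elt (x : P) : Prop := forall y : P, x <= y -> y = x.

(* Stated in this form, antichains are allowed; they are excluded as soon as
   the Hasse diagram is connected and has at least two vertices. *)
Definition length_one : Prop := forall x : P, minimal_elt x \/ maximal_elt x.

Definition covers (x y : P) : bool :=
  (x < y) && [forall z : P, ~~ (x < z < y)].

Definition hasse : rel P := fun x y => covers x y || covers y x.

Definition hasse_connected : Prop := forall x y : P, connect hasse x y.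

End Poset.

(* The quotient K^I / K(1,...,1). With I = P it is the lattice N for K = int
   and, when K is the field R of reals, it is N_R = N (x) R up to the canonical
   isomorphism. Coordinates are indexed by the elements of P themselves rather
   than by an enumeration of them. *)

Section DiagonalQuotient.
Variables (K : nzRingType) (I : finType).

Definition diagonal : {pred {ffun I -> K}} :=
  fun f => [forall i, [forall j, f i == f j]].

Lemma diagonalP (f : {ffun I -> K}) :
  reflect (exists c : K, f = [ffun=> c]) (f \in diagonal).
Proof.
rewrite /in_mem /= /diagonal; apply: (iffP idP) => [fP|[c ->]]; last first.
  by apply/forallP => i; apply/forallP => j; rewrite !ffunE.
case: (pickP I) => [i0 _|I0].
  exists (f i0); apply/ffunP => i; rewrite ffunE.
  by apply/eqP; move/forallP: fP => /(_ i)/forallP.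
by exists 0; apply/ffunP => i; have := I0 i.
Qed.

Lemma diagonal_zmod_closed : zmod_closed diagonal.
Proof.
split; first by apply/diagonalP; exists 0; apply/ffunP => i; rewrite !ffunE.
move=> f g /diagonalP[a ->] /diagonalP[b ->]; apply/diagonalP.
by exists (a - b); apply/ffunP => i; rewrite !ffunE.
Qed.

HB.instance Definition _ :=
  GRing.isZmodClosed.Build {ffun I -> K} diagonal diagonal_zmod_closed.

Definition diag_quot := Quotient.quot diagonal.

HB.instance Definition _ := GRing.Zmodule.on diag_quot.
HB.instance Definition _ := EqQuotient.on diag_quot.

Definition class (f : {ffun I -> K}) : diag_quot := \pi_diag_quot f.

Lemma class_eqP (f g : {ffun I -> K}) :
  reflect (exists c : K, f - g = [ffun=> c]) (class f == class g).
Proof. by rewrite -Quotient.idealrBE; exact: diagonalP. Qed.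

Definition rep (x : diag_quot) : {ffun I -> K} := repr x.

Lemma repK (x : diag_quot) : class (rep x) = x.
Proof. exact: reprK. Qed.

Lemma class_is_zmod_morphism : zmod_morphism class.
Proof. by move=> f g; rewrite /class; exact: raddfB. Qed.

HB.instance Definition _ := GRing.isZmodMorphism.Build
  {ffun I -> K} diag_quot class class_is_zmod_morphism.

Definition quot_scale (a : K) (x : diag_quot) : diag_quot :=
  class [ffun i => a * rep x i].

Lemma quot_scale_class a f :
  quot_scale a (class f) = class [ffun i => a * f i].
Proof.
apply/eqP/class_eqP; have /eqP/class_eqP[c /ffunP E] := repK (class f).
exists (a * c); apply/ffunP => i; have := E i.
by rewrite !ffunE -mulrBr => ->.
Qed.

Lemma quot_scaleA a b x :
  quot_scale a (quot_scale b x) = quot_scale (a * b) x.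
Proof.
rewrite -[x]repK !quot_scale_class; congr class.
by apply/ffunP => i; rewrite !ffunE mulrA.
Qed.

Lemma quot_scale1 : left_id 1 quot_scale.
Proof.
move=> x; rewrite -[x]repK quot_scale_class; congr class.
by apply/ffunP => i; rewrite !ffunE mul1r.
Qed.

Lemma quot_scaleDr : right_distributive quot_scale +%R.
Proof.
move=> a x y; rewrite -[x]repK -[y]repK -raddfD !quot_scale_class -raddfD.
by congr class; apply/ffunP => i; rewrite !ffunE mulrDr.
Qed.

Lemma quot_scaleDl x : {morph quot_scale^~ x : a b / a + b}.
Proof.
move=> a b; rewrite -[x]repK !quot_scale_class -raddfD.
by congr class; apply/ffunP => i; rewrite !ffunE mulrDl.
Qed.

HB.instance Definition _ := GRing.Zmodule_isLmodule.Build K diag_quot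
  quot_scaleA quot_scale1 quot_scaleDr quot_scaleDl.

(* The coordinate difference x_j - x_i, which does not depend on the
   representative. *)
Definition coord_diff (i j : I) (x : diag_quot) : K := rep x j - rep x i.

Lemma coord_diff_class i j f : coord_diff i j (class f) = f j - f i.
Proof.
have /eqP/class_eqP[c E] := repK (class f).
have rE k : rep (class f) k = c + f k.
  by have /ffunP/(_ k) := E; rewrite !ffunE => <-; rewrite subrK.
by rewrite /coord_diff !rE opprD addrACA subrr add0r.
Qed.

End DiagonalQuotient.

Section Toric.
Variables (R : realType) (I : finType).
Local Open Scope classical_set_scope.

Definition N := diag_quot int I.
Definition N_R := diag_quot R I.

HB.instance Definition _ := GRing.Lmodule.on N.
HB.instance Definition _ := GRing.Lmodule.on N_R.

(* The dual lattice M = Hom(N, Z). *)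
Definition M := {additive N -> int}.

(* The canonical map N -> N_R. *)
Definition lattice_incl (v : N) : N_R := class [ffun i => (rep v i)%:~R].

Lemma lattice_incl_class (f : {ffun I -> int}) :
  lattice_incl (class f) = class [ffun i => (f i)%:~R].
Proof.
apply/eqP/class_eqP; have /eqP/class_eqP[c /ffunP E] := repK (class f).
by exists c%:~R; apply/ffunP => i; have := E i; rewrite !ffunE -intrB => ->.
Qed.

Definition dual_cone (sigma : set N_R) : set {linear N_R -> R^o} :=
  [set m | forall x, sigma x -> 0 <= m x].

Definition is_face (sigma tau : set N_R) : Prop :=
  exists2 m, dual_cone sigma m & tau = sigma `&` [set x | m x = 0].

Definition half_line (x : N_R) : set N_R :=
  [set t *: x | t in [set t : R | 0 <= t]].

(* v is the ray generator of the ray (one-dimensional face) it spans, i.e. the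
   generator of the semigroup of lattice points of that ray. *)
Definition ray_generator (sigma : set N_R) (v : N) : Prop :=
  [/\ v != 0,
      is_face sigma (half_line (lattice_incl v))
    & forall w : N, half_line (lattice_incl v) (lattice_incl w) ->
        exists k : nat, w = v *+ k].

Definition constant_on_rays (sigma : set N_R) (r : nat) : Prop :=
  exists u : M, forall v : N, ray_generator sigma v -> u v = r%:Z.

(* The (Q-)Gorenstein property of the affine toric variety of sigma is read off
   from sigma: the index r is a positive integer, and r = 1 is the Gorenstein
   case. *)
Definition QGorenstein (sigma : set N_R) : Prop :=
  exists2 r : nat, (0 < r)%N & constant_on_rays sigma r.

Definition Gorenstein (sigma : set N_R) : Prop := constant_on_rays sigma 1.

End Toric.

Definition braid_cone (R : realType) (d : Order.disp_t) (P : finPOrderType d) :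
    set (N_R R P) :=
  [set x | forall i j : P, (i < j)%O -> 0 <= coord_diff i j x]%classic.

Arguments braid_cone R {d} P.

(* Main.v *)
(* If [x] is maximal and [C] is a connected component of P \ {x}, then P \ C is
   an up-set and both C and P \ C are connected; if [x] is minimal the same holds
   with C as the up-set. The indicator vector of such an up-set generates a ray
   of the braid cone, so a functional [u] with value [r] on all ray generators
   satisfies u(C) = -r, resp. u(C) = r. Since the coordinates of [u] sum to zero,
   summing over the components gives u_x = k r, resp. u_x = -k r, where [k] is
   the number of components. Hence [r] divides [u], and u / r shows that the
   Gorenstein condition holds. *)

From HB Require Import structures.
Require Import Defs.
From mathcomp Require Import all_boot all_order all_algebra.
From mathcomp Require Import classical_sets reals.

Set Implicit Arguments.
Unset Strict Implicit.
Unset Printing Implicit Defensive.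

Import Order.TTheory GRing.Theory Num.Theory.

Local Open Scope ring_scope.

(** * Indicator vectors and coordinate differences in the quotient *)

Definition indicator (K : nzRingType) (I : finType) (A : {set I}) :
  {ffun I -> K} := [ffun i => (i \in A)%:R].

Lemma coord_diff_linear (R : realType) (I : finType) (i j : I) (a : R)
    (x y : N_R R I) :
  coord_diff i j (a *: x + y) = a * coord_diff i j x + coord_diff i j y.
Proof.
have -> : a *: x + y = class ([ffun k => a * rep x k] + rep y).
  by rewrite raddfD /= repK.
by rewrite coord_diff_class /coord_diff !ffunE mulrBr opprD addrACA.
Qed.

Lemma coord_diffZ (R : realType) (I : finType) (i j : I) (a : R) (x : N_R R I) :
  coord_diff i j (a *: x) = a * coord_diff i j x.
Proof. by rewrite coord_diff_class !ffunE mulrBr. Qed.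

Lemma coord_diff_lattice_incl (R : realType) (I : finType) (i j : I) (v : N I) :
  coord_diff i j (lattice_incl R v) = (coord_diff i j v)%:~R.
Proof. by rewrite coord_diff_class !ffunE -intrB. Qed.

Lemma coord_diff_inj (K : nzRingType) (I : finType) (i0 : I)
    (x y : diag_quot K I) :
  (forall j, coord_diff i0 j x = coord_diff i0 j y) -> x = y.
Proof.
move=> E; rewrite -[x]repK -[y]repK; apply/eqP/class_eqP.
exists (rep x i0 - rep y i0); apply/ffunP => j; rewrite !ffunE.
have /eqP := E j; rewrite /coord_diff subr_eq => /eqP ->.
by rewrite [LHS]addrC !addrA addNr add0r addrC.
Qed.

Lemma coord_diff_indicator (K : nzRingType) (I : finType) (A : {set I})
    (i j : I) :
  coord_diff i j (class (indicator K A)) = (j \in A)%:R - (i \in A)%:R.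
Proof. by rewrite coord_diff_class !ffunE. Qed.

Lemma connect_invariant (T : finType) (S : eqType) (e : rel T) (f : T -> S) :
  (forall a b, e a b -> f a = f b) -> forall a b, connect e a b -> f a = f b.
Proof.
move=> fe a b /connectP[p + ->] {b}; elim: p a => //= c p IH a /andP[eac /IH <-].
exact: fe.
Qed.

(** * Ray generators coming from up-sets *)

Section Poset.
Variables (R : realType) (d : Order.disp_t) (P : finPOrderType d).
Implicit Types (F : {set P}) (x y z : P).

Definition same_side F : rel P :=
  fun i j => hasse i j && ((i \in F) == (j \in F)).

(** Connectedness of the Hasse diagram induced on [F] and of the one induced on its complement, in
    one condition that is symmetric under complementation. *)
Definition biconnected F : Prop :=
  forall i j, (i \in F) = (j \in F) -> connect (same_side F) i j.

Definition up_set F : Prop := forall i j, (i < j)%O -> i \in F -> j \in F.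

Lemma hasse_comparable i j : hasse i j -> (i < j)%O \/ (j < i :> P)%O.
Proof. by case/orP => /andP[? _]; [left | right]. Qed.

Lemma hasse_sym : symmetric (@hasse d P).
Proof. by move=> i j; rewrite /hasse orbC. Qed.

(** Without such a pair, membership in [F] would be constant along Hasse edges, hence constant by
    connectedness. The pair later measures the multiple of the indicator along its ray. *)
Lemma crossing_pair F i j : hasse_connected P -> up_set F ->
  i \notin F -> j \in F -> exists a b, [/\ (a < b)%O, a \notin F & b \in F].
Proof.
move=> hconn upF iF jF.
case: (boolP [exists a, exists b, [&& (a < b)%O, a \notin F & b \in F]]).
  by move=> /existsP[a /existsP[b /and3P[? ? ?]]]; exists a, b.
rewrite negb_exists => /forallP nocross.
have nc a b : (a < b)%O -> (a \in F) = (b \in F).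
  move=> ab; apply/idP/idP; first exact: upF.
  move: (nocross a); rewrite negb_exists => /forallP/(_ b).
  by rewrite ab /= negb_and negbK => /orP[|/negbTE->].
rewrite (connect_invariant (f := fun k => k \in F) _ (hconn i j)) ?jF // in iF.
by move=> a b /hasse_comparable[/nc|/nc].
Qed.

(** Every term is nonnegative on the braid cone, so there the sum vanishes only if every relation
    that stays inside [F] or inside its complement becomes an equality. This is the supporting
    functional of the ray. *)
Definition face_functional F (v : N_R R P) : R^o :=
  \sum_(p : P * P | (p.1 < p.2)%O && ((p.1 \in F) == (p.2 \in F)))
     coord_diff p.1 p.2 v.

Lemma face_functional_is_linear F : linear (face_functional F).
Proof.
move=> a x y; rewrite /face_functional scaler_sumr -big_split /=.
by apply: eq_bigr => p _; rewrite coord_diff_linear.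
Qed.

HB.instance Definition _ F := GRing.isLinear.Build R (N_R R P) R^o _
  (face_functional F) (face_functional_is_linear F).

Lemma ray_generator_indicator F i j : hasse_connected P -> up_set F ->
  biconnected F -> i \notin F -> j \in F ->
  ray_generator (braid_cone R P) (class (indicator int F)).
Proof.
move=> hconn upF biF iF jF.
have [a [b [ab aF bF]]] := crossing_pair hconn upF iF jF.
have incl_diff k l : coord_diff k l (lattice_incl R (class (indicator int F)))
    = (l \in F)%:R - (k \in F)%:R.
  by rewrite coord_diff_lattice_incl coord_diff_indicator intrB !mulrz_nat.
split.
- apply/eqP => /(congr1 (coord_diff a b)); rewrite coord_diff_indicator.
  by rewrite (negbTE aF) bF -(raddf0 (@class int P)) coord_diff_class !ffunE.
- exists (face_functional F : {linear _ -> _}).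
    move=> x xP; apply: sumr_ge0 => p /andP[lt_p _]; exact: xP.
  apply/seteqP; split=> [_ [t t0 <-]|x [xP /= x0]].
    split=> [k l kl|/=].
      rewrite coord_diffZ mulr_ge0 // incl_diff subr_ge0 ler_nat.
      by case: (boolP (k \in F)) => // /(upF _ _ kl) ->.
    apply: big1 => p /andP[_ /eqP E].
    by rewrite coord_diffZ incl_diff E subrr mulr0.
  (* A vanishing sum of nonnegative terms has only zero terms; biconnectedness then spreads equality
     over each side of [F]. *)
  have zero k l : same_side F k l -> rep x k = rep x l.
    have wlog_lt k' l' : (k' < l')%O -> (k' \in F) == (l' \in F) ->
        rep x k' = rep x l'.
      move=> lt_kl E; move/eqP: x0; rewrite psumr_eq0 => [/allP|].
        move=> /(_ (k', l')); rewrite mem_index_enum => /(_ isT) /=.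
        by rewrite lt_kl E /= subr_eq0 => /eqP.
      by move=> p /andP[lt_p _]; apply: xP.
    case/andP => /hasse_comparable[lt E|lt E]; first exact: wlog_lt.
    by rewrite (wlog_lt l k) // eq_sym.
  have const k l : (k \in F) = (l \in F) -> rep x k = rep x l.
    by move=> /biF; apply: connect_invariant.
  (* Being constant on both sides, [x] is determined by its jump from the complement to [F], which
     is read off at the crossing pair. *)
  exists (coord_diff a b x); first exact: xP.
  apply: (@coord_diff_inj _ _ a) => l; rewrite coord_diffZ incl_diff (negbTE aF).
  rewrite subr0; case: (boolP (l \in F)) => lF; rewrite ?mulr1 ?mulr0.
    by rewrite /coord_diff (const l b) // lF bF.
  by rewrite /coord_diff (const l a) ?subrr // (negbTE lF) (negbTE aF).
- move=> w [t /= t0 Ew].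
  have diff k l : (coord_diff k l w)%:~R = t * ((l \in F)%:R - (k \in F)%:R).
    by rewrite -coord_diff_lattice_incl -Ew coord_diffZ incl_diff.
  (* The real factor [t] equals the jump of the lattice point [w], so it is a nonnegative
     integer. *)
  have Et : (coord_diff a b w)%:~R = t by rewrite diff bF (negbTE aF) subr0 mulr1.
  have w0 : 0 <= coord_diff a b w by rewrite -(ler0z R) Et.
  exists `|coord_diff a b w|%N; apply: (@coord_diff_inj _ _ a) => l.
  rewrite -raddfMn coord_diff_class; apply: (@intr_inj R).
  rewrite diff -Et !ffunMnE !ffunE (negbTE aF) mul0rn !subr0.
  by case: (l \in F); rewrite ?mulr1 ?mulr0 ?mul0rn // natz gez0_abs.
Qed.

(** * Components left after removing one element *)

Definition avoiding x : rel P := fun y z => [&& hasse y z, y != x & z != x].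

(** A component of P \ {x} only when [y != x]: since [x] is isolated for [avoiding x], the choice
    [y = x] gives {x}. *)
Definition component x y : {set P} := [set z | connect (avoiding x) y z].

Lemma avoiding_sym x : connect_sym (avoiding x).
Proof.
by apply: sym_connect_sym => y z; rewrite /avoiding hasse_sym andbCA andbC -andbA.
Qed.

Lemma notin_component x y : y != x -> x \notin component x y.
Proof.
move=> yx; apply: contraNN yx; rewrite inE => /(connect_invariant (f := eq_op^~ x))->//.
by move=> a b /and3P[_ /negbTE-> /negbTE->].
Qed.

Lemma component_neq x y z : y != x -> z \in component x y -> z != x.
Proof. by move=> yx; apply: contraTneq => ->; apply: notin_component. Qed.

Lemma component_step x y a b : hasse a b -> a != x -> b != x ->
  (a \in component x y) = (b \in component x y).
Proof.
move=> ab ax bx; rewrite !inE; apply: same_connect_r; first exact: avoiding_sym.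
by apply: connect1; rewrite /avoiding ab ax bx.
Qed.

(** A path avoiding [x] from [y] never leaves the component. Outside it, a Hasse path to [x] cannot
    enter the component before reaching [x], so every outside element is joined to [x] within the
    complement. *)
Lemma biconnected_component x y : hasse_connected P -> y != x ->
  biconnected (component x y).
Proof.
move=> hconn yx; set C := component x y.
have symC : connect_sym (same_side C).
  by apply: sym_connect_sym => i j; rewrite /same_side hasse_sym eq_sym.
have inC i : i \in C -> connect (same_side C) y i.
  rewrite inE => /connectP[p + ->]; have: y \in C by rewrite inE.
  move: (y) => w; elim: p w => [//|c p IH] w wC /= /andP[/and3P[wc wx cx] pp].
  have cC: c \in C by rewrite -(component_step _ wc).
  apply: connect_trans (IH _ cC pp); apply: connect1.
  by rewrite /same_side wc wC cC.
have outC i : i \notin C -> connect (same_side C) i x.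
  have /connectP[p + +] := hconn i x.
  elim: p i => [|c p IH] i /= + + iC; first by move=> _ ->.
  case/andP=> ic pp px; have [->//|ix] := eqVneq i x.
  have cC : c \notin C.
    have [->|cx] := eqVneq c x; first exact: notin_component.
    by rewrite -(component_step _ ic).
  apply: connect_trans (IH _ pp px cC); apply: connect1.
  by rewrite /same_side ic (negbTE iC) (negbTE cC).
move=> i j; case: (boolP (i \in C)) => iC /esym.
  by move=> jC; apply: connect_trans (inC j jC); rewrite symC; apply: inC.
move=> /negbT/outC; rewrite symC => xj; exact: connect_trans (outC i iC) xj.
Qed.

Lemma length_one_hasse x y : length_one P -> (x < y)%O -> hasse x y.
Proof.
move=> hlen xy; rewrite /hasse /covers xy /=; apply/orP; left.
apply/forallP => z; apply/negP => /andP[xz zy].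
case: (hlen z) => [/(_ x (ltW xz)) E|/(_ y (ltW zy)) E].
  by rewrite E ltxx in xz.
by rewrite E ltxx in zy.
Qed.

(** A relation leaving the component upwards would have to end at [x], which minimality of [x]
    forbids. *)
Lemma up_set_component x y : length_one P -> minimal_elt x -> y != x ->
  up_set (component x y).
Proof.
move=> hlen xmin yx i j ij iC.
rewrite -(component_step _ (length_one_hasse hlen ij)) //.
  exact: component_neq iC.
apply/eqP => jx; rewrite jx in ij.
by have := xmin i (ltW ij) => E; rewrite E ltxx in ij.
Qed.

Lemma up_set_componentC x y : length_one P -> maximal_elt x -> y != x ->
  up_set (~: component x y).
Proof.
move=> hlen xmax yx i j ij; rewrite !(finset.in_setC, negbK) => iC; apply: contra iC => jC.
rewrite (component_step _ (length_one_hasse hlen ij)) //.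
  apply/eqP => ix; rewrite ix in ij.
  by have := xmax j (ltW ij) => E; rewrite E ltxx in ij.
exact: component_neq jC.
Qed.

Lemma biconnectedC F : biconnected F -> biconnected (~: F).
Proof.
move=> biF i j; rewrite !inE => /negb_inj/biF.
rewrite (@eq_connect _ (same_side F) (same_side (~: F))) // => k l.
by rewrite /same_side !inE (inj_eq negb_inj).
Qed.

(** * Divisibility of the functional by [r] *)

Lemma dvd_component (r : nat) (u : M P) x y : length_one P ->
    hasse_connected P -> y != x ->
    (forall v, ray_generator (braid_cone R P) v -> u v = r%:Z) ->
  (r%:Z %| u (class (indicator int (component x y))))%Z.
Proof.
move=> hlen hconn yx ur; set C := component x y.
have yC : y \in C by rewrite inE.
have xC : x \notin C by apply: notin_component.
have biC : biconnected C by apply: biconnected_component.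
case: (hlen x) => [xmin|xmax].
  have upC := up_set_component hlen xmin yx.
  by rewrite (ur _ (ray_generator_indicator hconn upC biC xC yC)).
have upC := up_set_componentC hlen xmax yx.
have yF : y \notin ~: C by rewrite finset.in_setC negbK.
have xF : x \in ~: C by rewrite finset.in_setC.
have E := ur _ (ray_generator_indicator hconn upC (biconnectedC biC) yF xF).
(* The two indicators add up to the all-ones vector, which is zero in [N]; hence the value on [C] is
   [-r]. *)
have -> : class (indicator int C) = - class (indicator int (~: C)).
  rewrite -raddfN; apply/eqP/class_eqP; exists 1; apply/ffunP => i.
  by rewrite !ffunE finset.in_setC opprK; case: (i \in C); rewrite ?addr0 ?add0r.
by rewrite raddfN E rpredN.
Qed.

Lemma indicator_sum (K : nzRingType) (I : finType) (A : {set I}) :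
  indicator K A = \sum_(i in A) indicator K [set i].
Proof.
apply/ffunP => j; rewrite sum_ffunE ffunE.
under eq_bigr do rewrite ffunE inE.
case: (boolP (j \in A)) => jA.
  by rewrite (bigD1 j) //= eqxx big1 ?addr0 // => i /andP[_ /negbTE];
    rewrite eq_sym => ->.
by rewrite big1 // => i iA; case: eqP iA jA => // -> ->.
Qed.

Lemma dvd_coordinate (r : nat) (u : M P) x : length_one P ->
    hasse_connected P ->
    (forall v, ray_generator (braid_cone R P) v -> u v = r%:Z) ->
  (r%:Z %| u (class (indicator int [set x])))%Z.
Proof.
move=> hlen hconn ur.
(* The indicators of all singletons also sum to the all-ones vector, hence the witness 1. *)
have ux : class (indicator int [set x]) =
    - \sum_(i | i != x) class (indicator int [set i]) :> N P.
  rewrite -raddf_sum -raddfN; apply/eqP/class_eqP; exists 1.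
  have := indicator_sum int [set: P]; rewrite (bigD1 x) //= opprK.
  by under [X in _ + X]eq_bigl do rewrite inE /=; move=> <-; apply/ffunP => j;
    rewrite !ffunE inE.
rewrite ux // raddfN rpredN raddf_sum.
(* Roots for [avoiding x] index the components. An index [y] that is [x] itself, or not a root,
   contributes an empty sum. *)
rewrite (partition_big (fingraph.root (avoiding x)) xpredT) //=.
apply: rpred_sum => y _.
have [z /andP[zx /eqP <-]|none] :=
    pickP (fun i => (i != x) && (fingraph.root (avoiding x) i == y)); last first.
  by rewrite big_pred0 ?dvdz0.
have := dvd_component hlen hconn zx ur; rewrite indicator_sum raddf_sum raddf_sum.
congr (_ %| _)%Z; apply: eq_bigl => i; rewrite inE.
rewrite (root_connect (@avoiding_sym x)) (avoiding_sym x i).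
apply/idP/andP => [zi|[]//]; split=> //.
by apply: component_neq zx _; rewrite inE.
Qed.

(** The indicators of singletons generate [N], so divisibility on them suffices. *)
Lemma dvd_functional (r : nat) (u : M P) (v : N P) : length_one P ->
    hasse_connected P ->
    (forall w, ray_generator (braid_cone R P) w -> u w = r%:Z) ->
  (r%:Z %| u v)%Z.
Proof.
move=> hlen hconn ur; rewrite -[v]repK.
have -> : rep v = \sum_i indicator int [set i] *~ rep v i.
  apply/ffunP => j; rewrite sum_ffunE (bigD1 j) //= big1 ?addr0 => [|i /negbTE ij].
    by rewrite ffunMzE ffunE inE eqxx intz.
  by rewrite ffunMzE ffunE inE eq_sym ij mul0rz.
rewrite !raddf_sum; apply: rpred_sum => i _.
by rewrite !raddfMz rpredMz //; apply: dvd_coordinate.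
Qed.

End Poset.

(** Integer division is not additive in general; it is here because all values of [u] are exact
    multiples of [r]. *)
Lemma exact_quotient_is_additive (I : finType) (u : M I) (r : nat) :
  (0 < r)%N -> (forall v, (r%:Z %| u v)%Z) ->
  zmod_morphism (fun v : N I => (u v %/ r%:Z)%Z).
Proof.
move=> r0 ru v w; have rN0 : r%:Z != 0 by rewrite eqz_nat -lt0n.
have /dvdzP[a va] := ru v; have /dvdzP[b wb] := ru w.
by rewrite raddfB va wb -mulrBl !mulzK.
Qed.

Theorem theorem6p3 (R : realType) (d : Order.disp_t) (P : finPOrderType d)
    (hcard : (2 <= #|P|)%N) (hlen : length_one P) (hconn : hasse_connected P) :
  Gorenstein (braid_cone R P) <-> QGorenstein (braid_cone R P).
Proof.
split=> [G|[r r0 [u ur]]]; first by exists 1%N.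
have ru v : (r%:Z %| u v)%Z by apply: dvd_functional ur.
pose u' : M P := HB.pack (fun v : N P => (u v %/ r%:Z)%Z)
  (GRing.isZmodMorphism.Build _ _ _ (exact_quotient_is_additive r0 ru)).
by exists u' => v /ur /= ->; rewrite divzz eqz_nat -lt0n r0.
Qed.
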